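(* For a commutative ring $A$, the following conditions are equivalent. (1) $A$ satisfies $\mathrm{LocTF}$. (2) $\Sigma(A)\subset\operatorname{KAss}_A(A)$. (3) $\Sigma(A)=\operatorname{KAss}_A(A)$.
   Context: All rings are commutative with identity. $\operatorname{Reg}(R)$ is the set of all non-zero-divisors of a ring $R$. An $R$-module $M$ is torsion-free if for every $a\in\operatorname{Reg}(R)$ multiplication by $a$ on $M$ is injective. A ring $A$ satisfies $\mathrm{LocTF}$ if, for every torsion-free $A$-module $M$ and every $P\in\operatorname{Spec}A$, the localization $M_P$ is torsion-free over $A_P$. Set $\Sigma(A)=\{P\in\operatorname{Spec}A\mid P\cap\operatorname{Reg}(A)=\emptyset\}$. A prime ideal $P$ of $A$ is a Krull prime of an $A$-module $M$ if for every $a\in P$ there exists $x\in M$ such that $a\in\operatorname{Ann}_A(x)\subset P$; $\operatorname{KAss}_A(M)$ is the set of all Krull primes of $M$. *)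

(* Defs.v *)
From HB Require Import structures.
From mathcomp Require Import all_boot all_order all_algebra.
From mathcomp Require Import ring.
From mathcomp Require Import boolp classical_sets.

Set Implicit Arguments.
Unset Strict Implicit.
Unset Printing Implicit Defensive.

Import GRing.Theory.
Local Open Scope ring_scope.
Local Open Scope classical_set_scope.
Local Open Scope quotient_scope.

(* Rings are of type [comPzRingType]: commutative with identity, the zero ring
   being allowed; [idealr] and [prime_idealr] of ring_quotient.v exclude it. *)

Definition Reg (A : comPzRingType) : set A :=
  [set a | forall b, a * b = 0 -> b = 0].

Arguments Reg A : clear implicits.

Definition torsion_free (A : comPzRingType) (M : lmodType A) : Prop :=
  forall a : A, Reg A a -> injective (fun x : M => a *: x).

Definition is_ideal (A : comPzRingType) (I : set A) : Prop :=
  [/\ I 0, forall a b, I a -> I b -> I (a + b) & forall r a, I a -> I (r * a)].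

Definition is_prime_ideal (A : comPzRingType) (P : set A) : Prop :=
  [/\ is_ideal P, ~ P 1 & forall a b, P (a * b) -> P a \/ P b].

Record Spec (A : comPzRingType) := MkSpec {
  prime_set : set A;
  prime_setP : is_prime_ideal prime_set }.

Record mulset (A : comPzRingType) := MulSet {
  mulset_set : set A;
  mulset1 : mulset_set 1;
  mulsetM : forall s t, mulset_set s -> mulset_set t -> mulset_set (s * t) }.

(* The localization of M at S is the quotient of M * S by
   (m, s) ~ (n, t) iff u (t m) = u (s n) for some u in S; the class of (m, s)
   is [frac m s], and the lemmas [fracP], [fracD], [fracN], [fracM] and [fracZ]
   characterize equality and the operations. *)
Module Localization.
Section Denominators.
Variables (A : comPzRingType) (S : mulset A).

Definition den := {s : A | s \in mulset_set S}.
#[export] HB.instance Definition _ := Choice.on den.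

Definition dval (s : den) : A := val s.
Lemma denP (s : den) : mulset_set S (dval s).
Proof. by have /set_mem := valP s. Qed.

Definition mkden (s : A) (Ss : mulset_set S s) : den := exist _ s (mem_set Ss).
Definition den1 : den := mkden (mulset1 S).
Definition denM (s t : den) : den := mkden (mulsetM (denP s) (denP t)).

Lemma dval1 : dval den1 = 1. Proof. by []. Qed.
Lemma dvalM s t : dval (denM s t) = dval s * dval t. Proof. by []. Qed.

Lemma denMA : associative denM.
Proof. by move=> s t u; apply: val_inj; rewrite /= mulrA. Qed.
Lemma denMC : commutative denM.
Proof. by move=> s t; apply: val_inj; rewrite /= mulrC. Qed.
Lemma den1M : left_id den1 denM.
Proof. by move=> s; apply: val_inj; rewrite /= mul1r. Qed.

End Denominators.
Arguments dval {A S} s : simpl never.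

Section ZmodLoc.
Variables (A : comPzRingType) (S : mulset A) (M : lmodType A).
Local Notation den := (den S).
Local Notation pair := (M * den)%type.
Implicit Types x y z : pair.

Definition equivl : rel pair := fun x y =>
  `[< exists2 u, mulset_set S u &
        u *: (dval y.2 *: x.1) = u *: (dval x.2 *: y.1) >].

Lemma equivlP x y : reflect
  (exists2 u, mulset_set S u &
     u *: (dval y.2 *: x.1) = u *: (dval x.2 *: y.1)) (equivl x y).
Proof. exact: asboolP. Qed.

Lemma equivl_refl : reflexive equivl.
Proof. by move=> x; apply/equivlP; exists 1 => //; apply: mulset1. Qed.

Lemma equivl_sym : symmetric equivl.
Proof. by move=> x y; apply/equivlP/equivlP => -[u Su e]; exists u. Qed.

Lemma equivl_trans : transitive equivl.
Proof.
move=> [n t] [m s] [p r] /equivlP[u Su /= e1] /equivlP[v Sv /= e2].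
apply/equivlP; exists (u * v * dval t) => /=.
  by apply: mulsetM (denP t); apply: mulsetM.
move: e1 e2; rewrite !scalerA => e1 e2.
have -> : u * v * dval t * dval r = (v * dval r) * (u * dval t) by ring.
rewrite -scalerA e1 scalerA.
have -> : v * dval r * (u * dval s) = (u * dval s) * (v * dval r) by ring.
by rewrite -scalerA e2 scalerA; congr (_ *: _); ring.
Qed.

Canonical equivl_equiv :=
  EquivRel equivl equivl_refl equivl_sym equivl_trans.

Definition type := {eq_quot equivl}.
#[export] HB.instance Definition _ : EqQuotient _ equivl type := EqQuotient.on type.
#[export] HB.instance Definition _ := Choice.on type.

Definition frac (m : M) (s : den) : type := \pi_type (m, s).

Lemma fracP m s n t : frac m s = frac n t <->
  exists2 u, mulset_set S u & u *: (dval t *: m) = u *: (dval s *: n).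
Proof.
split; first by move=> /eqmodP /equivlP.
by move=> h; apply/eqmodP/equivlP.
Qed.

Lemma frac_ind (Q : type -> Prop) : (forall m s, Q (frac m s)) -> forall a, Q a.
Proof. by move=> h; elim/quotW => -[]. Qed.

Lemma frac_cancel u m s :
  frac (dval (u : den) *: m) (denM u s) = frac m s.
Proof.
apply/fracP; exists 1; first exact: mulset1.
by rewrite dvalM !scalerA; congr (_ *: _); ring.
Qed.

Lemma frac_den0 s t : frac 0 s = frac 0 t.
Proof. by apply/fracP; exists 1; [exact: mulset1|rewrite !scaler0]. Qed.

Definition add2 x y : pair := (dval y.2 *: x.1 + dval x.2 *: y.1, denM x.2 y.2).
Definition opp1 x : pair := (- x.1, x.2).

Definition zero : type := frac 0 (den1 S).
Definition add : type -> type -> type := lift_op2 type add2.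
Definition opp : type -> type := lift_op1 type opp1.

Lemma add_frac m s n t :
  add (frac m s) (frac n t) = frac (dval t *: m + dval s *: n) (denM s t).
Proof.
rewrite /add; unlock.
case em: (repr (frac m s)) => [m' s']; case en: (repr (frac n t)) => [n' t'] /=.
have /fracP[u Su e1] : frac m' s' = frac m s by rewrite /frac -em reprK.
have /fracP[v Sv e2] : frac n' t' = frac n t by rewrite /frac -en reprK.
apply/fracP; exists (u * v); first exact: mulsetM.
move: e1 e2; rewrite /= !dvalM !scalerDr !scalerA => e1 e2; congr (_ + _).
  have -> : u * v * (dval s * dval t) * dval t'
          = (v * dval t * dval t') * (u * dval s) by ring.
  by rewrite -scalerA e1 scalerA; congr (_ *: _); ring.
have -> : u * v * (dval s * dval t) * dval s'
        = (u * dval s * dval s') * (v * dval t) by ring.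
by rewrite -scalerA e2 scalerA; congr (_ *: _); ring.
Qed.

Lemma opp_frac m s : opp (frac m s) = frac (- m) s.
Proof.
rewrite /opp; unlock; case em: (repr (frac m s)) => [m' s'] /=.
have /fracP[u Su e] : frac m' s' = frac m s by rewrite /frac -em reprK.
by apply/fracP; exists u => //; rewrite !scalerN e.
Qed.

Lemma addA : associative add.
Proof.
elim/frac_ind => m s; elim/frac_ind => n t; elim/frac_ind => p r.
rewrite !add_frac denMA !dvalM !scalerDr !scalerA addrA.
by congr (frac (_ *: _ + _ *: _ + _ *: _) _); ring.
Qed.

Lemma addC : commutative add.
Proof.
elim/frac_ind => m s; elim/frac_ind => n t.
by rewrite !add_frac denMC addrC.
Qed.

Lemma add0 : left_id zero add.
Proof.
elim/frac_ind => m s.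
by rewrite add_frac scaler0 add0r dval1 scale1r den1M.
Qed.

Lemma addN : left_inverse zero opp add.
Proof.
elim/frac_ind => m s.
by rewrite opp_frac add_frac scalerN addNr; apply: frac_den0.
Qed.

#[export] HB.instance Definition _ := GRing.isZmodule.Build type addA addC add0 addN.

Lemma fracD m s n t :
  frac m s + frac n t = frac (dval t *: m + dval s *: n) (denM s t).
Proof. exact: add_frac. Qed.

Lemma fracN m s : - frac m s = frac (- m) s.
Proof. exact: opp_frac. Qed.

End ZmodLoc.

Section Ring.
Variables (A : comPzRingType) (S : mulset A).
Local Notation den := (den S).

Section Scale.
Variable M : lmodType A.

Definition scale2 (x : A^o * den) (y : M * den) : M * den :=
  ((x.1 : A) *: y.1, denM x.2 y.2).

Definition scale : type S A^o -> type S M -> type S M :=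
  locked (fun a b => \pi_(type S M) (scale2 (repr a) (repr b))).

Lemma scale_frac (a : A) s (m : M) t :
  scale (frac (a : A^o) s) (frac m t) = frac (a *: m) (denM s t).
Proof.
rewrite /scale; unlock.
case ea: (repr (frac _ s)) => [a' s']; case em: (repr (frac m t)) => [m' t'] /=.
have /fracP[u Su e1] : frac a' s' = frac (a : A^o) s by rewrite /frac -ea reprK.
have /fracP[v Sv e2] : frac m' t' = frac m t by rewrite /frac -em reprK.
apply/fracP; exists (u * v); first exact: mulsetM.
have {}e1 : u * (dval s * (a' : A)) = u * (dval s' * a) := e1.
move: e2; rewrite /= !dvalM !scalerA => e2.
have -> : u * v * (dval s * dval t) * (a' : A)
        = u * (dval s * (a' : A)) * (v * dval t) by ring.
by rewrite -scalerA e2 e1 scalerA; congr (_ *: _); ring.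
Qed.

End Scale.

Lemma scaleA (M : lmodType A) a b (c : type S M) :
  scale a (scale b c) = scale (scale a b) c.
Proof.
elim/frac_ind: a => a s; elim/frac_ind: b => b t; elim/frac_ind: c => m r.
by rewrite !scale_frac denMA; congr frac; apply: scalerA.
Qed.

Lemma scale1 (M : lmodType A) : left_id (frac (1 : A^o) (den1 S)) (@scale M).
Proof. by elim/frac_ind => m s; rewrite scale_frac den1M scale1r. Qed.

Lemma scaleDr (M : lmodType A) : right_distributive (@scale M) +%R.
Proof.
elim/frac_ind => a r; elim/frac_ind => m s; elim/frac_ind => n t.
rewrite !(fracD, scale_frac) -(frac_cancel r).
congr frac; last by apply: val_inj; rewrite -!/(dval _) !dvalM; ring.
by rewrite !dvalM !scalerDr !scalerA; congr (_ *: _ + _ *: _); ring.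
Qed.

Lemma scaleDl (M : lmodType A) (c : type S M) :
  {morph (@scale M)^~ c : a b / a + b}.
Proof.
move: c; elim/frac_ind => m r; elim/frac_ind => a s; elim/frac_ind => b t.
rewrite !(fracD, scale_frac) -(frac_cancel r).
congr frac; last by apply: val_inj; rewrite -!/(dval _) !dvalM; ring.
rewrite !dvalM -[dval t *: a]/(dval t * a) -[dval s *: b]/(dval s * b).
by rewrite scalerDl scalerDr !scalerA; congr (_ *: _ + _ *: _); ring.
Qed.

(* A_S is the localization at S of A as a module over itself. *)
Definition ring := type S A^o.
#[export] HB.instance Definition _ := GRing.Zmodule.on ring.

Definition mul : ring -> ring -> ring := @scale A^o.

Lemma mulC : commutative mul.
Proof.
elim/frac_ind => a s; elim/frac_ind => b t.
by rewrite /mul !scale_frac denMC; congr frac; apply: mulrC.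
Qed.

#[export] HB.instance Definition _ := GRing.Zmodule_isComPzRing.Build ring
  (@scaleA A^o) mulC (@scale1 A^o) (fun a b c => @scaleDl A^o c a b).

#[export] HB.instance Definition _ (M : lmodType A) :=
  GRing.Zmodule_isLmodule.Build ring (type S M)
    (@scaleA M) (@scale1 M) (@scaleDr M) (@scaleDl M).

Lemma fracZ (M : lmodType A) (a : A) s (m : M) t :
  (frac (a : A^o) s : ring) *: frac m t = frac (a *: m) (denM s t).
Proof. exact: scale_frac. Qed.

Lemma fracM (a b : A) s t :
  (frac (a : A^o) s : ring) * frac (b : A^o) t = frac (a * b : A^o) (denM s t).
Proof. exact: scale_frac. Qed.

Lemma frac1 : 1 = frac (1 : A^o) (den1 S) :> ring.
Proof. by []. Qed.

Lemma frac0 (M : lmodType A) : 0 = frac (0 : M) (den1 S).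
Proof. by []. Qed.

End Ring.
Module Exports. HB.reexport. End Exports.
End Localization.
Export Localization.Exports.

Notation loc_ring := Localization.ring.
Notation loc_mod := Localization.type.

Definition prime_compl (A : comPzRingType) (P : Spec A) : mulset A.
Proof.
exists (~` prime_set P).
- by case: (prime_setP P).
- by case: (prime_setP P) => _ _ PM s t nPs nPt /PM[].
Defined.

Definition LocTF (A : comPzRingType) : Prop :=
  forall M : lmodType A, torsion_free M ->
  forall P : Spec A,
    @torsion_free (loc_ring (prime_compl P)) (loc_mod (prime_compl P) M).

Definition Sigma (A : comPzRingType) : set (Spec A) :=
  [set P | prime_set P `&` Reg A = set0].
Arguments Sigma A : clear implicits.

Definition Ann (A : comPzRingType) (M : lmodType A) (x : M) : set A :=
  [set a | a *: x = 0].

Definition Krull_prime (A : comPzRingType) (M : lmodType A) (P : Spec A) : Prop :=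
  forall a, prime_set P a -> exists x : M, Ann x a /\ Ann x `<=` prime_set P.

Definition KAss (A : comPzRingType) (M : lmodType A) : set (Spec A) :=
  [set P | Krull_prime M P].
Arguments KAss A M : clear implicits.

(* Main.v *)
(* Every Krull prime of A consists of zero divisors.  Suppose that every P in
   Sigma(A) is a Krull prime of A, and that a regular r/s in A_P kills a nonzero
   class m/t with M torsion-free, so that u r m = 0 with u outside P.  Then
   Ann(m) contains no product c d with c regular and d outside P, so it lies in
   a prime Q of Sigma(A) contained in P; as u r is in Q and Q is a Krull prime,
   r/s is a zero divisor of A_P, a contradiction.
   Conversely, for P in Sigma(A) the module A/P is torsion-free over A, and a/1
   kills the nonzero class of 1 in (A/P)_P for each a in P, so LocTF forces a/1
   to be a zero divisor in A_P. *)
From HB Require Import structures.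
Require Import Defs.
From mathcomp Require Import all_boot all_order all_algebra.
From mathcomp Require Import boolp classical_sets.
From mathcomp Require Import ring.

Local Open Scope classical_set_scope.
Local Open Scope ring_scope.
Local Open Scope quotient_scope.

Import GRing.Theory.
Import Localization.

(** * Zero tests in modules and their localizations *)

Lemma torsion_freeP (A : comPzRingType) (M : lmodType A) :
  torsion_free M <-> forall (a : A) (m : M), Reg A a -> a *: m = 0 -> m = 0.
Proof.
split=> [tfM a m /tfM inj am0|tfM a /tfM inj x y /= axy].
  by apply: inj; rewrite /= am0 scaler0.
by apply/eqP; rewrite -subr_eq0; apply/eqP/inj; rewrite scalerBr axy subrr.
Qed.

Lemma is_ideal_Ann (A : comPzRingType) (M : lmodType A) (x : M) :
  is_ideal (Ann x).
Proof.
rewrite /Ann; split=> [|a b /= ax bx|r a /= ax]; first exact: scale0r.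
  by rewrite scalerDl ax bx addr0.
by rewrite -scalerA ax scaler0.
Qed.

Lemma frac_eq0 (A : comPzRingType) (S : mulset A) (M : lmodType A) (m : M)
    (s : den S) :
  frac m s = 0 <-> exists2 u, mulset_set S u & u *: m = 0.
Proof.
rewrite frac0 fracP dval1 scaler0 scale1r.
by split=> -[u Su um0]; exists u; rewrite // um0 scaler0.
Qed.

(** The denominator [s] is a unit of the localization, so only [a] matters, and it suffices to test
    [a] against the fractions [b/1]. *)
Lemma Reg_frac (A : comPzRingType) (S : mulset A) (a : A) (s : den S) :
  Reg (loc_ring S) (frac (a : A^o) s) <->
  forall u b, mulset_set S u -> u * a * b = 0 ->
    exists2 v, mulset_set S v & v * b = 0.
Proof.
split=> [ra u b Su uab0|ra].
  have /frac_eq0 // : frac (b : A^o) (den1 S) = 0.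
  apply: ra; rewrite fracM; apply/frac_eq0; exists u => //.
  by rewrite -uab0 -mulrA.
elim/frac_ind => b t; rewrite fracM => /frac_eq0[u Su uab0].
apply/frac_eq0; apply: (ra u) => //.
by rewrite -mulrA.
Qed.

(** * Prime ideals disjoint from a multiplicative set *)

Lemma Reg1 (A : comPzRingType) : Reg A 1.
Proof. by move=> b; rewrite mul1r. Qed.

Lemma RegM (A : comPzRingType) (a b : A) : Reg A a -> Reg A b -> Reg A (a * b).
Proof. by move=> ra rb c; rewrite -mulrA => /ra/rb. Qed.

(** This set contains both [Reg A] and [S]. For [S] the complement of P, the primes disjoint from it
    are the members of Sigma(A) contained in P. *)
Definition regular_mulset (A : comPzRingType) (S : mulset A) : mulset A.
Proof.
exists [set x | exists c d, [/\ Reg A c, mulset_set S d & x = c * d]].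
  by exists 1, 1; split; [exact: Reg1|exact: mulset1|rewrite mulr1].
move=> _ _ [c [d [rc Sd ->]]] [c' [d' [rc' Sd' ->]]].
by exists (c * c'), (d * d'); split;
  [exact: RegM|exact: mulsetM|rewrite mulrACA].
Defined.

(** By Zorn's lemma some ideal Q is maximal among those containing [I] and disjoint from [S]. If a
    and b lie outside Q, then Q + Aa and Q + Ab both meet [S], hence so does Q + Aab, and ab is not
    in Q. *)
Lemma prime_avoiding (A : comPzRingType) (S : mulset A) (I : set A) :
  is_ideal I -> I `&` mulset_set S = set0 ->
  exists Q : Spec A, I `<=` prime_set Q /\ prime_set Q `&` mulset_set S = set0.
Proof.
move=> idI IS0.
(* Joining I to X makes the empty chain harmless in Zorn's lemma. *)
pose P X := is_ideal (I `|` X) /\ (I `|` X) `&` mulset_set S = set0.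
have [F FP Ftot|Q0 [[idQ QS0] Qmax]] := @Zorn_bigcup A P.
  have [I0 ID IM] := idI.
  split; last first.
    apply/seteqP; split=> // x [[Ix|[X FX Xx]] Sx].
      by rewrite -IS0.
    by have [_ <-] := FP _ FX; split=> //; right.
  split; first by left.
    (* Of two members of the chain one contains the other, so a sum can be formed inside the larger
       one. *)
    have key X Y a b : F X -> F Y -> X `<=` Y -> (I `|` X) a -> (I `|` Y) b ->
        (I `|` \bigcup_(Z in F) Z) (a + b).
      move=> FX FY XY Xa Yb; have [[_ YD _] _] := FP _ FY.
      have Ya : (I `|` Y) a by case: Xa => [|/XY]; [left|right].
      by have [Iab|Yab] := YD _ _ Ya Yb; [left|right; exists Y].
    move=> a b [Ia|[X FX Xa]] [Ib|[Y FY Yb]].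
    - by left; exact: ID.
    - by apply: (key Y Y) => //; [left|right].
    - by apply: (key X X) => //; [right|left].
    - have [XY|YX] := Ftot _ _ FX FY.
        by apply: (key X Y) => //; right.
      by rewrite addrC; apply: (key Y X) => //; right.
  move=> r a [Ia|[X FX Xa]]; first by left; exact: IM.
  have [[_ _ XM] _] := FP _ FX.
  have [|Ira|Xra] := XM r a; [by right|by left|by right; exists X].
move: idQ QS0; set Q := I `|` Q0 => idQ QS0.
have IQ : I `<=` Q by move=> x; left.
(* Zorn's lemma gives maximality of [Q0]; it passes to [Q] because a competitor [J] above [Q]
   already absorbs [I]. *)
have {}Qmax J : is_ideal J -> Q `<=` J -> J `&` mulset_set S = set0 -> J `<=` Q.
  move=> idJ QJ JS0; apply: contrapT => nJQ.
  have IJ : I `|` J = J by apply/setUidPr => x /IQ/QJ.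
  apply: (Qmax J); last by rewrite /P IJ.
  split=> [x Q0x|JQ0]; first by apply: QJ; right.
  by apply: nJQ => x /JQ0; right.
have [Q_0 QD QM] := idQ.
have notS x : Q x -> mulset_set S x -> False.
  by move=> Qx Sx; rewrite -[False]/(set0 x) -QS0.
have meet a : ~ Q a -> exists2 r, mulset_set S r & exists q b, Q q /\ r = q + b * a.
  move=> nQa; apply: contrapT => nex; apply: nQa.
  pose J := [set x | exists q b, Q q /\ x = q + b * a].
  suff : J `<=` Q by apply; exists 0, 1; rewrite add0r mul1r.
  apply: Qmax.
  - split.
    + by exists 0, 0; rewrite mul0r addr0.
    + move=> _ _ [q [b [Qq ->]]] [q' [b' [Qq' ->]]].
      by exists (q + q'), (b + b'); split; [exact: QD|ring].
    + move=> r _ [q [b [Qq ->]]]; exists (r * q), (r * b).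
      by split; [exact: QM|ring].
  - by move=> x Qx; exists x, 0; rewrite mul0r addr0.
  - by apply/seteqP; split=> // x [Jx Sx]; apply: nex; exists x.
have Qprime : is_prime_ideal Q.
  split=> // [Q1|a b Qab]; first exact: notS Q1 (mulset1 S).
  apply: contrapT => /not_orP[/meet[r Sr [q [c [Qq er]]]]].
  move=> /meet[t St [q' [c' [Qq' et]]]].
  apply: (notS (r * t)); last exact: mulsetM.
  (* Each summand is a multiple of [q], of [q'] or of [a * b], all in [Q]. *)
  have -> : r * t = t * q + (c * a * q' + c * c' * (a * b)).
    by rewrite er et; ring.
  by apply: (QD); [|apply: (QD)]; apply: QM.
by exists (MkSpec Qprime).
Qed.

(** * The module A/I *)

Section IdealQuotient.
Variables (A : comPzRingType) (I : set A) (idI : is_ideal I).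

(* The unused proof lets canonical structures infer that [ideal_pred] is closed
   under subtraction. *)
Definition ideal_pred of is_ideal I : {pred A} := fun x => x \in I.
Local Notation J := (ideal_pred idI).

Lemma ideal_predE x : (x \in J) = (x \in I).
Proof. by []. Qed.

Lemma ideal_pred_zmod_closed : zmod_closed J.
Proof.
have [I0 ID IM] := idI; split=> [|x y]; rewrite !ideal_predE !inE // => Ix Iy.
by apply: ID => //; rewrite -mulN1r; apply: IM.
Qed.

HB.instance Definition _ := GRing.isZmodClosed.Build A J ideal_pred_zmod_closed.

Definition ideal_quotient := Quotient.quot J.
HB.instance Definition _ := GRing.Zmodule.on ideal_quotient.

Definition quotient_class (x : A) : ideal_quotient := \pi_(Quotient.quot J) x.

Lemma quotient_class_eq x y : quotient_class x = quotient_class y <-> I (x - y).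
Proof.
have := Quotient.idealrBE J x y; rewrite ideal_predE => IJ.
by split=> [/eqP|/mem_set]; [rewrite -IJ => /set_mem|rewrite IJ => /eqP].
Qed.

Lemma quotient_class_ind (T : ideal_quotient -> Prop) :
  (forall x, T (quotient_class x)) -> forall q, T q.
Proof. by move=> h; elim/quotW. Qed.

Lemma quotient_classD x y :
  quotient_class (x + y) = quotient_class x + quotient_class y.
Proof. exact: (raddfD (\pi_(Quotient.quot J))). Qed.

Definition quotient_scale (a : A) (q : ideal_quotient) : ideal_quotient :=
  quotient_class (a * repr (q : Quotient.quot J)).

Lemma quotient_scaleE a x :
  quotient_scale a (quotient_class x) = quotient_class (a * x).
Proof.
apply/quotient_class_eq; rewrite -mulrBr.
have [_ _ IM] := idI; apply: IM; apply/quotient_class_eq.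
exact: reprK.
Qed.

Lemma quotient_scaleA a b q :
  quotient_scale a (quotient_scale b q) = quotient_scale (a * b) q.
Proof. by elim/quotient_class_ind: q => x; rewrite !quotient_scaleE mulrA. Qed.

Lemma quotient_scale1 : left_id 1 quotient_scale.
Proof. by elim/quotient_class_ind=> x; rewrite quotient_scaleE mul1r. Qed.

Lemma quotient_scaleDr : right_distributive quotient_scale +%R.
Proof.
move=> a; elim/quotient_class_ind=> x; elim/quotient_class_ind=> y.
by rewrite -quotient_classD !quotient_scaleE mulrDr quotient_classD.
Qed.

Lemma quotient_scaleDl q : {morph quotient_scale^~ q : a b / a + b}.
Proof.
move=> a b; elim/quotient_class_ind: q => x.
by rewrite !quotient_scaleE mulrDl quotient_classD.
Qed.

HB.instance Definition _ := GRing.Zmodule_isLmodule.Build A ideal_quotient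
  quotient_scaleA quotient_scale1 quotient_scaleDr quotient_scaleDl.

Lemma quotient_scale_eq0 (a x : A) :
  a *: quotient_class x = 0 <-> I (a * x).
Proof.
have class0 : quotient_class 0 = 0 by exact: (raddf0 (\pi_(Quotient.quot J))).
by rewrite -[a *: _]/(quotient_scale _ _) quotient_scaleE -class0
  quotient_class_eq subr0.
Qed.

End IdealQuotient.
Arguments ideal_quotient {A I} idI.
Arguments quotient_class {A I} idI x.

(** * Sigma(A), Krull primes and LocTF *)

Lemma prime_ideal_idealP {A : comPzRingType} (P : Spec A) : is_ideal (prime_set P).
Proof. by have [] := prime_setP P. Qed.

Lemma torsion_free_prime_quotient (A : comPzRingType) (P : Spec A) :
  Sigma A P -> torsion_free (ideal_quotient (prime_ideal_idealP P)).
Proof.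
move=> PReg; apply/torsion_freeP => a q ra.
elim/quotient_class_ind: q => x /quotient_scale_eq0 Pax.
have [_ _ /(_ _ _ Pax)[Pa|Px]] := prime_setP P.
  by have : set0 a by rewrite -PReg.
by rewrite -[LHS]scale1r; apply/quotient_scale_eq0; rewrite mul1r.
Qed.

(** A regular element kills only 0, and Ann(0) = A lies in no prime. *)
Lemma KAss_sub_Sigma (A : comPzRingType) : KAss A A^o `<=` Sigma A.
Proof.
move=> P KP; apply/seteqP; split=> // a [Pa ra].
have [x [ax0 AnnP]] := KP _ Pa.
have [_ nP1 _] := prime_setP P; apply: nP1; apply: AnnP.
by rewrite /Ann /= (ra _ ax0) scaler0.
Qed.

Lemma LocTF_Sigma_sub_KAss (A : comPzRingType) :
  LocTF A -> Sigma A `<=` KAss A A^o.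
Proof.
move=> locA P SP a Pa; apply: contrapT => nex.
have [_ nP1 _] := prime_setP P.
have ra : Reg (loc_ring (prime_compl P)) (frac (a : A^o) (den1 _)).
  apply/Reg_frac => u b nPu uab0; apply: contrapT => nv; apply: nex.
  (* [a] kills [u * b]. Any [v] outside P killing [u * b] would make [v * u], also outside P, kill
     [b], so Ann([u * b]) lies in P when [b/1] is nonzero. *)
  exists (u * b); split; first by rewrite /Ann /= -uab0 -mulrA; apply: mulrCA.
  move=> v vub0; apply: contrapT => nPv; apply: nv; exists (v * u).
    exact: (mulsetM (m := prime_compl P)).
  by rewrite -mulrA.
have /locA/(_ P)/torsion_freeP tf := torsion_free_prime_quotient _ _ SP.
pose e : loc_mod (prime_compl P) (ideal_quotient (prime_ideal_idealP P)) :=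
  frac (quotient_class _ 1) (den1 _).
have /frac_eq0[u nPu /quotient_scale_eq0] : e = 0; last by rewrite mulr1.
apply: tf ra _; rewrite fracZ; apply/frac_eq0; exists 1; first exact: mulset1.
by rewrite scale1r; apply/quotient_scale_eq0; rewrite mulr1.
Qed.

Lemma Sigma_sub_KAss_LocTF (A : comPzRingType) :
  Sigma A `<=` KAss A A^o -> LocTF A.
Proof.
move=> SK M /torsion_freeP tf P; apply/torsion_freeP.
elim/frac_ind => r s; elim/frac_ind => m t /Reg_frac rr.
rewrite fracZ => /frac_eq0[u nPu]; rewrite scalerA => urm0.
apply/frac_eq0; apply: contrapT => AnnP.
have [|Q [AnnQ QT0]] := prime_avoiding _ (regular_mulset _ (prime_compl P)) _
    (is_ideal_Ann _ _ m).
  (* If [c * d] kills [m] with [c] regular, torsion-freeness gives [d *: m = 0], against [m/t] being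
     nonzero. *)
  apply/seteqP; split=> // x [/= xm0 [c [d [rc nPd ec]]]].
  apply: AnnP; exists d => //; apply: tf rc _.
  by rewrite scalerA -ec.
have QP : prime_set Q `<=` prime_set P.
  move=> x Qx; apply: contrapT => nPx.
  rewrite -[False]/(set0 x) -QT0; split=> //.
  by exists 1, x; split; [exact: Reg1| |rewrite mul1r].
have SQ : Sigma A Q.
  apply/seteqP; split=> // x [Qx rx]; rewrite -QT0; split=> //.
  by exists x, 1; split; [|exact: mulset1|rewrite mulr1].
(* Since Ann([x]) lies in Q and hence in P, [x/1] is nonzero in A_P although [r/s] kills it. *)
have [x [urx0 AnnxQ]] := SK Q SQ _ (AnnQ _ urm0).
have [v nPv vx0] := rr u x nPu urx0.
exact/nPv/QP/AnnxQ.
Qed.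

Theorem theorem6p8 (A : comPzRingType) :
  [<-> LocTF A;
       Sigma A `<=` KAss A A^o;
       Sigma A = KAss A A^o].
Proof.
tfae; first exact: LocTF_Sigma_sub_KAss.
  by move=> SK; apply/seteqP; split=> //; exact: KAss_sub_Sigma.
by move=> SK; apply: Sigma_sub_KAss_LocTF; rewrite SK.
Qed.
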